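(* Let $\mathbf{E}$ be a field and let $H$ be a subgroup of $\mathrm{Aut}(\mathbf{E})$. An element $\alpha\in\mathbf{E}$ is algebraic over the fixed field $\mathbf{E}^H$ if and only if its $H$-orbit $\mathcal{O}_H(\alpha)$ is finite, i.e. $\ell(\mathcal{O}_H(\alpha))<\infty$. Moreover, in that case: (i) the $H$-orbit polynomial $f_{\alpha,H}(x)=\prod_{\beta\in\mathcal{O}_H(\alpha)}(x-\beta)$ coincides with the minimal polynomial of $\alpha$ over $\mathbf{E}^H$; (ii) $\alpha$ is separable over $\mathbf{E}^H$; and (iii) $[\mathbf{E}^H(\alpha):\mathbf{E}^H]=\ell(\mathcal{O}_H(\alpha))$.
   Context: $\mathrm{Aut}(\mathbf{E})$ is the group of all field automorphisms of $\mathbf{E}$. For a subgroup $H$ of $\mathrm{Aut}(\mathbf{E})$, the fixed field is $\mathbf{E}^H=\{\alpha\in\mathbf{E}\mid\sigma(\alpha)=\alpha\text{ for all }\sigma\in H\}$. For $\alpha\in\mathbf{E}$, the $H$-orbit is $\mathcal{O}_H(\alpha)=\{\sigma(\alpha)\mid\sigma\in H\}$ and its length is $\ell(\mathcal{O}_H(\alpha))=|\mathcal{O}_H(\alpha)|$. The orbit polynomial, defined when the orbit is finite, is the product over the distinct elements of the orbit, a priori an element of $\mathbf{E}[x]$. *)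

(* Defs.v *)
From HB Require Import structures.
From mathcomp Require Import all_boot all_order all_fingroup all_algebra all_field.
From mathcomp Require Import finmap.
From mathcomp Require Import boolp classical_sets functions cardinality.

Set Implicit Arguments.
Unset Strict Implicit.
Unset Printing Implicit Defensive.

Import GRing.Theory.

Local Open Scope classical_set_scope.
Local Open Scope ring_scope.

Record field_aut (E : fieldType) := FieldAut {
  aut_fun :> {rmorphism E -> E};
  aut_bij : bijective aut_fun }.

HB.instance Definition _ (E : fieldType) := gen_eqMixin (field_aut E).
HB.instance Definition _ (E : fieldType) := gen_choiceMixin (field_aut E).

Section AutGroup.
Variable E : fieldType.
Implicit Types s t : field_aut E.

Lemma field_autP s t : s =1 t -> s = t.
Proof.
case: s t => [f bf] [g bg] /= fg.
suff efg : f = g by rewrite efg in bf *; congr FieldAut; exact: Prop_irrelevance.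
case: f g fg {bf bg} => [f [[f0] [fM]]] [g [[g0] [gM]]] /= /funext fg.
rewrite fg in f0 fM *.
by congr (GRing.RMorphism.Pack (GRing.RMorphism.Class _ _));
   [congr GRing.isNmodMorphism.Axioms_ | congr GRing.isMonoidMorphism.Axioms_];
   exact: Prop_irrelevance.
Qed.

Definition aut_one : field_aut E := @FieldAut E idfun (inv_bij (fun=> erefl)).

(* composition, [(s * t) x = s (t x)] *)
Definition aut_mul s t : field_aut E :=
  @FieldAut E (s \o t) (bij_comp (aut_bij s) (aut_bij t)).

Lemma aut_inv_ex s : {t : field_aut E | cancel s t}.
Proof.
apply: cid; case: (aut_bij s) => g sK gK.
have gB : zmod_morphism g by exact: can2_zmod_morphism sK gK.
have gM : monoid_morphism g by exact: can2_monoid_morphism sK gK.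
pose gA := GRing.isZmodMorphism.Build E E g gB.
pose gR := GRing.isMonoidMorphism.Build E E g gM.
pose g' : {rmorphism E -> E} := HB.pack g gA gR.
by exists (@FieldAut E g' (Bijective (gK : cancel g' s) sK)).
Qed.

Definition aut_inv s : field_aut E := sval (aut_inv_ex s).

Lemma aut_mulA : associative aut_mul.
Proof. by move=> s t u; exact: field_autP. Qed.

Lemma aut_1mul : left_id aut_one aut_mul.
Proof. by move=> s; exact: field_autP. Qed.

Lemma aut_mul1 : right_id aut_one aut_mul.
Proof. by move=> s; exact: field_autP. Qed.

Lemma aut_mulV : left_inverse aut_one aut_inv aut_mul.
Proof. by move=> s; apply: field_autP => x; exact: (svalP (aut_inv_ex s)). Qed.

Lemma aut_Vmul : right_inverse aut_one aut_inv aut_mul.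
Proof.
move=> s; apply: field_autP => x; apply: (bij_inj (aut_bij (aut_inv s))).
exact: (svalP (aut_inv_ex s)).
Qed.

HB.instance Definition _ := isGroup.Build (field_aut E)
  aut_mulA aut_1mul aut_mul1 aut_mulV aut_Vmul.

End AutGroup.

Section Fixed.
Variables (E : fieldType) (H : set (field_aut E)).

Definition fixed_pred : {pred E} :=
  [pred x | `[< forall s, H s -> s x = x >]].

Lemma fixed_divring_closed : divring_closed fixed_pred.
Proof.
split=> [|x y /asboolP Hx /asboolP Hy|x y /asboolP Hx /asboolP Hy];
  apply/asboolP => s Hs.
- exact: rmorph1.
- by rewrite rmorphB Hx ?Hy.
- by rewrite fmorph_div Hx ?Hy.
Qed.

HB.instance Definition _ :=
  GRing.isDivringClosed.Build E fixed_pred fixed_divring_closed.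

Record fixed_field := FixedField {
  fixed_val : E;
  _ : fixed_val \in fixed_pred }.

HB.instance Definition _ := [isSub for fixed_val].
HB.instance Definition _ := [Choice of fixed_field by <:].
HB.instance Definition _ := [SubChoice_isSubIntegralDomain of fixed_field by <:].
HB.instance Definition _ := [SubIntegralDomain_isSubField of fixed_field by <:].

Definition fixed_incl : {rmorphism fixed_field -> E} := val.

Definition aut_orbit (a : E) : set E := [set s a | s in H].

(* [fset_set] sends infinite sets to [fset0]: the next two definitions are
   meaningful only for finite orbits. *)
Definition orbit_length (a : E) : nat := #|` fset_set (aut_orbit a)|.

Definition orbit_poly (a : E) : {poly E} :=
  \prod_(b <- fset_set (aut_orbit a)) ('X - b%:P).

End Fixed.

(* The base field K is given by its embedding [iota] into E. *)

Section SimpleExtension.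
Variables (K E : fieldType) (iota : {rmorphism K -> E}) (a : E).

Definition is_min_poly (p : {poly K}) : Prop :=
  [/\ p \is monic, root (map_poly iota p) a &
      forall q : {poly K}, q != 0 -> root (map_poly iota q) a ->
        (size p <= size q)%N].

(* [0] if [a] is transcendental over [K] *)
Definition min_poly : {poly K} := xget 0 [set p | is_min_poly p].

Definition separable_over : Prop :=
  algebraicOver iota a /\ separable_poly min_poly.

(* K(a): the intersection of the subfields of E containing K and a *)
Definition adjoin_pred : {pred E} :=
  [pred x | `[< forall S : {pred E}, divring_closed S ->
                  (forall c : K, iota c \in S) -> a \in S -> x \in S >]].

Lemma adjoin_divring_closed : divring_closed adjoin_pred.
Proof.
split=> [|x y /asboolP Sx /asboolP Sy|x y /asboolP Sx /asboolP Sy];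
  apply/asboolP => S dS KS aS; case: (dS) => S1 SB SV.
- exact: S1.
- by apply: SB; [exact: Sx | exact: Sy].
- by apply: SV; [exact: Sx | exact: Sy].
Qed.

HB.instance Definition _ :=
  GRing.isDivringClosed.Build E adjoin_pred adjoin_divring_closed.

Record adjoin := Adjoin {
  adjoin_val : E;
  _ : adjoin_val \in adjoin_pred }.

HB.instance Definition _ := [isSub for adjoin_val].
HB.instance Definition _ := [Choice of adjoin by <:].
HB.instance Definition _ := [SubChoice_isSubIntegralDomain of adjoin by <:].
HB.instance Definition _ := [SubIntegralDomain_isSubField of adjoin by <:].

Lemma adjoin_base (c : K) : iota c \in adjoin_pred.
Proof. by apply/asboolP => S _ KS _; exact: KS. Qed.

Definition adjoin_scale (c : K) (x : adjoin) : adjoin :=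
  Adjoin (adjoin_base c) * x.

Lemma adjoin_scaleA c d x :
  adjoin_scale c (adjoin_scale d x) = adjoin_scale (c * d) x.
Proof. by apply: val_inj; rewrite !rmorphM /= rmorphM mulrA. Qed.

Lemma adjoin_scale1 : left_id 1 adjoin_scale.
Proof. by move=> x; apply: val_inj; rewrite rmorphM /= rmorph1 mul1r. Qed.

Lemma adjoin_scaleDr : right_distributive adjoin_scale +%R.
Proof. by move=> c x y; exact: mulrDr. Qed.

Lemma adjoin_scaleDl x : {morph adjoin_scale^~ x : c d / c + d}.
Proof.
by move=> c d; apply: val_inj; rewrite rmorphD !rmorphM /= rmorphD mulrDl.
Qed.

HB.instance Definition _ := GRing.Zmodule_isLmodule.Build K adjoin
  adjoin_scaleA adjoin_scale1 adjoin_scaleDr adjoin_scaleDl.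

End SimpleExtension.

(* [Vector.axiom n V] is the type of linear bijections from V to K^n. *)
Definition has_dimension (K : fieldType) (V : lmodType K) (n : nat) : Prop :=
  inhabited (Vector.axiom n V).

(* Main.v *)
Require Import Defs.
From mathcomp Require Import all_boot all_order all_fingroup all_algebra all_field.
From mathcomp Require Import finmap.
From mathcomp Require Import boolp classical_sets functions cardinality.

(* Every root in E of a polynomial over the fixed field is carried by H to
   further roots, so an algebraic element has a finite orbit. Conversely H
   permutes a finite orbit, so the orbit polynomial has H-invariant
   coefficients; it divides every polynomial over the fixed field vanishing at
   the element, hence it is minimal, and it is separable since its roots are
   distinct. *)

Set Implicit Arguments.
Unset Strict Implicit.
Unset Printing Implicit Defensive.

Import GRing.Theory.

Local Open Scope classical_set_scope.
Local Open Scope ring_scope.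

(** An infinite root set would contain [size p] distinct roots, one more than the degree allows. *)
Lemma finite_root_set (R : idomainType) (p : {poly R}) :
  p != 0 -> finite_set [set x | root p x].
Proof.
move=> p0; apply: contrapT => /(infinite_set_fset (size p))[B BA].
apply/negP; rewrite -ltnNge; apply: max_poly_roots; rewrite ?fset_uniq //.
by apply/allP => x xB; exact: BA.
Qed.

Section MinimalPolynomial.
Variables (K E : fieldType) (iota : {rmorphism K -> E}) (a : E).

Lemma is_min_poly_unique (p q : {poly K}) :
  is_min_poly iota a p -> is_min_poly iota a q -> p = q.
Proof.
move=> [pm pa pmin] [qm qa qmin]; apply/eqP; rewrite -subr_eq0.
have p0 := monic_neq0 pm; have q0 := monic_neq0 qm.
have spq : size p = size q by apply/eqP; rewrite eqn_leq pmin ?qmin.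
apply: contraT => pq0.
have /(pmin _ pq0) : root (map_poly iota (p - q)) a.
  by rewrite /root rmorphB hornerD hornerN (eqP pa) (eqP qa) subrr.
have sp : (0 < size p)%N by rewrite size_poly_gt0.
suff : (size (p - q)%R < size p)%N by rewrite ltnNge => /negPf ->.
rewrite -(prednK sp) ltnS; apply/leq_sizeP => j; rewrite leq_eqVlt coefB.
(* At the top index both leading coefficients are 1 and cancel; beyond it both coefficients
   vanish. *)
case/predU1P => [<-|ltj].
  move: pm qm; rewrite !monicE /lead_coef -spq => /eqP-> /eqP->.
  by rewrite subrr.
by rewrite !nth_default ?subrr // -?spq -(prednK sp).
Qed.

Lemma min_polyE (p : {poly K}) : is_min_poly iota a p -> min_poly iota a = p.
Proof. by move=> pP; apply: xget_unique => // q /is_min_poly_unique; exact. Qed.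

Variable p : {poly K}.
Hypothesis p_min : is_min_poly iota a p.

(** Write [p = e * gcdp p q] with a nonconstant gcd. If [a] is a root of the gcd, then [q] vanishes
    at [a]; if it is a root of [e], then [e] is smaller than [p], against minimality. *)
Lemma root_coprime_min_poly (q : {poly K}) :
  ~~ root (map_poly iota q) a -> coprimep p q.
Proof.
case: p_min => pm pa pmin; apply: contraNT => ncop.
have /dvdpP[e pe] := dvdp_gcdl p q.
have /dvdpP[f qf] := dvdp_gcdr p q.
have p0 := monic_neq0 pm.
have := p0; rewrite {1}pe mulf_eq0 negb_or => /andP[e0 g0].
have : root (map_poly iota p) a by [].
rewrite {1}pe rmorphM rootM => /orP[ea|ga]; last first.
  by rewrite qf rmorphM rootM ga orbT.
have := pmin _ e0 ea.
rewrite {1}pe size_mul //.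
have : (1 < size (gcdp p q))%N.
  by rewrite ltn_neqAle eq_sym ncop size_poly_gt0.
by case: (size (gcdp p q)) => [|[|m]] // _; rewrite !addnS /= ltnNge leq_addr.
Qed.

(** The values at [a] of polynomials over [K] already form a subfield containing [K] and [a];
    division by [p] then bounds the degree. *)
Lemma adjoinP (x : E) : x \in adjoin_pred iota a ->
  exists2 q : {poly K}, (size q < size p)%N & x = (map_poly iota q).[a].
Proof.
have [pm pa _] := p_min.
pose S : {pred E} :=
  [pred x | `[< exists q : {poly K}, x = (map_poly iota q).[a] >]].
have SI y : y \in S -> y^-1 \in S.
  move=> /asboolP[q ->]; apply/asboolP.
  have [/eqP->|nqa] := boolP (root (map_poly iota q) a).
    by exists 0; rewrite invr0 rmorph0 horner0.
  have /Bezout_eq1_coprimepP[[u v] /= uv] := root_coprime_min_poly nqa.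
  (* Evaluating the Bezout relation [u * p + v * q = 1] at [a] kills the first term, so [v] gives
     the inverse. *)
  exists v; apply: (mulIf nqa); rewrite mulVf //.
  rewrite -hornerM -rmorphM.
  have <- : (map_poly iota (u * p + v * q)).[a] = 1.
    by rewrite uv rmorph1 hornerC.
  by rewrite rmorphD rmorphM hornerD hornerM (eqP pa) mulr0 add0r.
have Sdiv : divring_closed S.
  split.
  - by apply/asboolP; exists 1; rewrite rmorph1 hornerC.
  - move=> _ _ /asboolP[q ->] /asboolP[r ->]; apply/asboolP; exists (q - r).
    by rewrite rmorphB hornerD hornerN.
  - move=> _ y /asboolP[q ->] /SI /asboolP[r ->]; apply/asboolP; exists (q * r).
    by rewrite rmorphM hornerM.
move=> /asboolP /(_ S Sdiv) xS.
have /asboolP[q ->] : x \in S.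
  apply: xS => [c|]; apply/asboolP.
    by exists c%:P; rewrite map_polyC hornerC.
  by exists 'X; rewrite map_polyX hornerX.
exists (q %% p); first by rewrite ltn_modp monic_neq0.
by rewrite {1}(divp_eq q p) rmorphD rmorphM hornerD hornerM (eqP pa) mulr0 add0r.
Qed.

Lemma horner_adjoin (q : {poly K}) :
  (map_poly iota q).[a] \in adjoin_pred iota a.
Proof.
have aA : a \in adjoin_pred iota a by apply/asboolP.
rewrite horner_poly rpred_sum // => i _.
by rewrite rpredM ?rpredX // adjoin_base.
Qed.

(** Row vectors encode polynomials of degree below that of [p]. Evaluation at [a] is injective on
    them by minimality of [p], and surjective by [adjoinP]. *)
Lemma adjoin_dimension : has_dimension (adjoin iota a) (size p).-1.
Proof.
have [pm _ pmin] := p_min.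
have sp : (0 < size p)%N by rewrite size_poly_gt0 monic_neq0.
pose n := (size p).-1.
pose g (v : 'rV[K]_n) : adjoin iota a := Adjoin (horner_adjoin (rVpoly v)).
have g_lin : linear g.
  move=> c u v; apply: val_inj => /=.
  by rewrite linearP /= rmorphD /= map_polyZ hornerD hornerZ.
have g_inj : injective g.
  move=> u v /(congr1 val)/= /eqP.
  rewrite -subr_eq0 -hornerN -hornerD -rmorphB => uv.
  apply: (can_inj rVpolyK); apply/eqP; rewrite -subr_eq0; apply: contraT => uv0.
  have := pmin _ uv0 uv; rewrite leqNgt -linearB.
  by rewrite -(prednK sp) ltnS size_poly.
have g_surj x : {v | g v = x}.
  apply: cid; have /adjoinP[q sq qx] := valP x.
  exists (poly_rV q); apply: val_inj; rewrite /= poly_rV_K ?qx //.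
  by rewrite -ltnS prednK.
have gK : cancel (fun x => sval (g_surj x)) g by move=> x; exact: svalP (g_surj x).
(* [Vector.axiom] asks for the map towards row vectors, hence the inverse of [g]; it inherits
   linearity from [g]. *)
split; exists (fun x => sval (g_surj x)).
  by move=> c x y; apply: g_inj; rewrite g_lin !gK.
by exists g => // v; apply: g_inj; rewrite gK.
Qed.

End MinimalPolynomial.

Section Orbit.
Variables (E : fieldType) (H : set (field_aut E)).
Hypothesis subgroup_H : group_closed (mem H).
Variable a : E.

Lemma orbit_self : aut_orbit H a a.
Proof. by exists 1%g => //; have [/set_mem] := subgroup_H. Qed.

Lemma aut_orbit_stable s b : H s -> aut_orbit H a b -> aut_orbit H a (s b).
Proof.
move=> Hs [t Ht <-]; exists (s * t)%g => //; apply: set_mem.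
by apply: (group_closedM subgroup_H); apply: mem_set.
Qed.

Lemma root_aut_orbit (q : {poly fixed_field H}) b :
  root (map_poly (fixed_incl H) q) a -> aut_orbit H a b ->
  root (map_poly (fixed_incl H) q) b.
Proof.
move=> qa [s Hs <-]; rewrite -(fmorph_root s) in qa.
(* Since [s] fixes the coefficients of [q], it sends roots to roots. *)
suff <- : map_poly s (map_poly (fixed_incl H) q) = map_poly (fixed_incl H) q.
  by [].
rewrite -map_poly_comp; apply: eq_map_poly => x /=.
by have /asboolP/(_ s Hs) := valP x.
Qed.

Lemma algebraic_finite_orbit :
  algebraicOver (fixed_incl H) a -> finite_set (aut_orbit H a).
Proof.
move=> [q q0 qa].
pose roots := [set x | root (map_poly (fixed_incl H) q) x].
apply: (@sub_finite_set _ _ roots).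
  by move=> b; exact: root_aut_orbit.
by apply: finite_root_set; rewrite map_poly_eq0.
Qed.

Hypothesis orbit_fin : finite_set (aut_orbit H a).

Lemma orbit_poly_fixed : orbit_poly H a \is a polyOver (fixed_pred H).
Proof.
apply/polyOverP => i; apply/asboolP => s Hs.
suff {2}<- : map_poly s (orbit_poly H a) = orbit_poly H a by rewrite coef_map.
rewrite /orbit_poly rmorph_prod /=.
under eq_bigr do rewrite rmorphB /= map_polyX map_polyC /=.
rewrite -(big_map s xpredT (fun b => 'X - b%:P)); apply: perm_big.
have uM : uniq (map s (fset_set (aut_orbit H a))).
  by rewrite (map_inj_uniq (fmorph_inj _)) fset_uniq.
apply: uniq_perm; rewrite ?fset_uniq //.
(* The image of the orbit under the injective [s] has as many elements as the orbit, so inclusion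
   suffices for equality. *)
apply: (uniq_min_size uM _ _).2; last by rewrite size_map.
move=> _ /mapP[b bO ->]; move: bO.
by rewrite !in_fset_set // => /set_mem bO; apply/mem_set/aut_orbit_stable.
Qed.

Lemma orbit_poly_min : exists2 p : {poly fixed_field H},
  map_poly (fixed_incl H) p = orbit_poly H a & is_min_poly (fixed_incl H) a p.
Proof.
(* The default 0 is harmless: all coefficients lie in the fixed field. *)
pose p := map_poly (insubd (0 : fixed_field H)) (orbit_poly H a).
have pE : map_poly (fixed_incl H) p = orbit_poly H a.
  apply/polyP => i; rewrite coef_map coef_map_id0 /=.
    by rewrite insubdK //; exact: (polyOverP orbit_poly_fixed).
  by apply: val_inj; rewrite insubdK ?rpred0.
exists p => //; split.
- by rewrite -(map_monic (fixed_incl H)) pE monic_prod_XsubC.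
- by rewrite pE root_prod_XsubC in_fset_set //; exact/mem_set/orbit_self.
move=> q q0 qa.
rewrite -(size_map_poly (fixed_incl H) p) -(size_map_poly (fixed_incl H) q) pE.
(* The orbit consists of distinct roots of [q], so the orbit polynomial divides [q] over [E]. *)
apply: dvdp_leq; first by rewrite map_poly_eq0.
apply: uniq_roots_dvdp; last by rewrite uniq_rootsE fset_uniq.
by apply/allP => b; rewrite in_fset_set // => /set_mem; exact: root_aut_orbit.
Qed.

End Orbit.

Theorem theorem4p1 (E : fieldType) (H : set (field_aut E))
    (subgroup_H : group_closed (mem H)) (a : E) :
  (algebraicOver (fixed_incl H) a <-> finite_set (aut_orbit H a)) /\
  (finite_set (aut_orbit H a) ->
    [/\ map_poly (fixed_incl H) (min_poly (fixed_incl H) a) = orbit_poly H a,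
        separable_over (fixed_incl H) a
      & has_dimension (adjoin (fixed_incl H) a) (orbit_length H a)]).
Proof.
split.
  split; first exact: algebraic_finite_orbit.
  move=> /(orbit_poly_min subgroup_H)[p _ [pm pa _]].
  by exists p => //; exact: monic_neq0.
move=> /(orbit_poly_min subgroup_H)[p pE p_min].
have [pm pa _] := p_min; rewrite /separable_over (min_polyE p_min); split => //.
  split; first by exists p => //; exact: monic_neq0.
  (* Separability can be tested over [E], where [p] splits into distinct linear factors. *)
  by rewrite -(separable_map (fixed_incl H)) pE separable_prod_XsubC fset_uniq.
suff -> : orbit_length H a = (size p).-1 by exact: adjoin_dimension.
by rewrite -(size_map_poly (fixed_incl H)) pE size_prod_XsubC.
Qed.
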